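(* Let $\mathscr{A}$ be an abelian category, let $\mathscr{E}$ be a subcategory of $\mathscr{A}$, and let $\mathscr{T}$ be an $\mathscr{E}$-preresolving subcategory of $\mathscr{A}$ admitting an $\mathscr{E}$-proper generator $\mathscr{C}$. Assume that $\mathscr{T}\subseteq{\mathscr{C}^{\bot}}\cap{^{\bot}\mathscr{C}}$ and that $\mathscr{C}$ is closed under direct summands. Then for an object $A$ in $\mathscr{A}$, $\mathscr{T}\text{-}\dim A=\mathscr{C}\text{-}\dim A$ if one of the following conditions is satisfied: (1) $\mathscr{C}\text{-}\dim A<\infty$, $\mathscr{E}=\mathscr{C}$ and $\mathscr{T}$ is closed under kernels of $\mathscr{C}$-proper epimorphisms. (2) $\mathscr{C}\text{-}\dim A<\infty$, $\mathscr{E}=\mathscr{C}$ and $\mathscr{C}\text{-}\dim^{<\infty}$ is closed under direct summands. (3) $A$ is an object in $\mathscr{T}^{\bot}$ and $\mathscr{C}$ is a cogenerator for $\mathscr{T}$.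
   Context: All subcategories of $\mathscr{A}$ are full and additive. A sequence $\mathbb{S}$ in $\mathscr{A}$ is $\operatorname{Hom}_{\mathscr{A}}(\mathscr{E},-)$-exact if $\operatorname{Hom}_{\mathscr{A}}(E,\mathbb{S})$ is exact for every object $E$ in $\mathscr{E}$. For subcategories $\mathscr{C}\subseteq\mathscr{T}$ of $\mathscr{A}$: $\mathscr{C}$ is an $\mathscr{E}$-proper generator for $\mathscr{T}$ if for any object $T$ in $\mathscr{T}$ there exists a $\operatorname{Hom}_{\mathscr{A}}(\mathscr{E},-)$-exact exact sequence $0\to T'\to C\to T\to 0$ in $\mathscr{A}$ with $C$ in $\mathscr{C}$ and $T'$ in $\mathscr{T}$; $\mathscr{C}$ is a cogenerator for $\mathscr{T}$ if for any object $T$ in $\mathscr{T}$ there exists an exact sequence $0\to T\to C\to T'\to 0$ with $C$ in $\mathscr{C}$ and $T'$ in $\mathscr{T}$. $\mathscr{T}$ is $\mathscr{E}$-preresolving if (i) $\mathscr{T}$ admits an $\mathscr{E}$-proper generator, and (ii) $\mathscr{T}$ is closed under $\mathscr{E}$-proper extensions: for any $\operatorname{Hom}_{\mathscr{A}}(\mathscr{E},-)$-exact exact sequence $0\to A_1\to A_2\to A_3\to 0$ in $\mathscr{A}$ with $A_1,A_3$ in $\mathscr{T}$, also $A_2$ is in $\mathscr{T}$. $\mathscr{T}$ is closed under kernels of $\mathscr{C}$-proper epimorphisms if for any $\operatorname{Hom}_{\mathscr{A}}(\mathscr{C},-)$-exact exact sequence $0\to A_1\to A_2\to A_3\to 0$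 in $\mathscr{A}$ with $A_2,A_3$ in $\mathscr{T}$, also $A_1$ is in $\mathscr{T}$. For a subcategory $\mathscr{X}$: $\mathscr{X}^{\bot}$ is the subcategory of objects $A$ with $\operatorname{Ext}^i_{\mathscr{A}}(X,A)=0$ for all $X$ in $\mathscr{X}$ and all $i\geq 1$; ${}^{\bot}\mathscr{X}$ is the subcategory of objects $A$ with $\operatorname{Ext}^i_{\mathscr{A}}(A,X)=0$ for all $X$ in $\mathscr{X}$ and all $i\geq 1$; $\mathscr{X}\text{-}\dim A$ is the infimum of the integers $n\geq 0$ for which there exists an exact sequence $0\to X_n\to\cdots\to X_0\to A\to 0$ in $\mathscr{A}$ with all $X_i$ in $\mathscr{X}$ ($\infty$ if none exists); $\mathscr{X}\text{-}\dim^{<\infty}$ is the subcategory of objects of finite $\mathscr{X}$-dimension. *)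

(* Defs.v *)
From HB Require Import structures.
From Stdlib Require Import Relation_Operators.
From mathcomp Require Import all_boot all_order all_algebra.
From mathcomp Require Import boolp.

Set Implicit Arguments.
Unset Strict Implicit.
Unset Printing Implicit Defensive.

Import GRing.Theory.
Local Open Scope ring_scope.

Record preadditiveCategory := PreadditiveCategory {
  obj :> Type;
  hom : obj -> obj -> zmodType;
  idm : forall X, hom X X;
  comp : forall X Y Z, hom Y Z -> hom X Y -> hom X Z;
  compA : forall W X Y Z (h : hom Y Z) (g : hom X Y) (f : hom W X),
    comp h (comp g f) = comp (comp h g) f;
  comp1m : forall X Y (f : hom X Y), comp (idm Y) f = f;
  compm1 : forall X Y (f : hom X Y), comp f (idm X) = f;
  compDl : forall X Y Z (g g' : hom Y Z) (f : hom X Y),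
    comp (g + g') f = comp g f + comp g' f;
  compDr : forall X Y Z (g : hom Y Z) (f f' : hom X Y),
    comp g (f + f') = comp g f + comp g f'
}.

Arguments hom {p} X Y.
Arguments idm {p} X.
Arguments comp {p X Y Z} g f.

Notation "g \oc f" := (comp g f) (at level 40, left associativity).

Section Abelian.
Variable A : preadditiveCategory.

Definition mono (X Y : A) (f : hom X Y) : Prop :=
  forall W (g h : hom W X), f \oc g = f \oc h -> g = h.

Definition epi (X Y : A) (f : hom X Y) : Prop :=
  forall Z (g h : hom Y Z), g \oc f = h \oc f -> g = h.

Definition zero_object (Z : A) : Prop :=
  forall X, (forall f : hom X Z, f = 0) /\ (forall f : hom Z X, f = 0).

Definition biproduct (S X Y : A) : Prop :=
  exists (i1 : hom X S) (i2 : hom Y S) (p1 : hom S X) (p2 : hom S Y),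
    [/\ p1 \oc i1 = idm X, p2 \oc i2 = idm Y, p1 \oc i2 = 0, p2 \oc i1 = 0
      & i1 \oc p1 + i2 \oc p2 = idm S].

Definition is_kernel (K X Y : A) (k : hom K X) (f : hom X Y) : Prop :=
  f \oc k = 0 /\
  forall W (g : hom W X), f \oc g = 0 -> exists! u : hom W K, k \oc u = g.

Definition is_cokernel (X Y Q : A) (q : hom Y Q) (f : hom X Y) : Prop :=
  q \oc f = 0 /\
  forall Z (g : hom Y Z), g \oc f = 0 -> exists! u : hom Q Z, u \oc q = g.

Definition abelian : Prop :=
  (exists Z : A, zero_object Z) /\
  (forall X Y : A, exists S, biproduct S X Y) /\
  (forall (X Y : A) (f : hom X Y), exists K (k : hom K X), is_kernel k f) /\
  (forall (X Y : A) (f : hom X Y), exists Q (q : hom Y Q), is_cokernel q f) /\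
  (forall (X Y : A) (f : hom X Y), mono f ->
     exists Z (g : hom Y Z), is_kernel f g) /\
  (forall (X Y : A) (f : hom X Y), epi f ->
     exists W (g : hom W X), is_cokernel f g).

Definition is_image (X Y I : A) (m : hom I Y) (f : hom X Y) : Prop :=
  exists Q (q : hom Y Q), is_cokernel q f /\ is_kernel m q.

Definition exact_at (X Y Z : A) (f : hom X Y) (g : hom Y Z) : Prop :=
  exists I (m : hom I Y), is_image m f /\ is_kernel m g.

(* 0 -> X -> Y -> Z -> 0 is exact *)
Definition short_exact (X Y Z : A) (f : hom X Y) (g : hom Y Z) : Prop :=
  [/\ mono f, exact_at f g & epi g].

(* [cseq n B X] is the type of composable sequences B -> E_n -> ... -> E_1 -> X
   with n intermediate objects, hence n.+1 morphisms. *)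
Fixpoint cseq (n : nat) (B X : A) : Type :=
  match n with
  | 0 => hom B X
  | m.+1 => {E : A & (hom B E * cseq m E X)%type}
  end.

Fixpoint exact_after (n : nat) (W B X : A) (f : hom W B) :
    cseq n B X -> Prop :=
  match n with
  | 0 => fun g => exact_at f g /\ epi g
  | m.+1 => fun s =>
      let: existT _ (g, r) := s in exact_at f g /\ exact_after g r
  end.

(* 0 -> B -> E_n -> ... -> E_1 -> X -> 0 is exact *)
Definition exact_cseq (n : nat) (B X : A) : cseq n B X -> Prop :=
  match n with
  | 0 => fun g => mono g /\ epi g
  | m.+1 => fun s =>
      let: existT _ (g, r) := s in mono g /\ exact_after g r
  end.

(* Morphisms of sequences with prescribed left end [b] and right end [x]. *)
Fixpoint cseq_mor (n : nat) (B X B' X' : A) (b : hom B B') (x : hom X X') :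
    cseq n B X -> cseq n B' X' -> Prop :=
  match n with
  | 0 => fun g g' => x \oc g = g' \oc b
  | m.+1 => fun s s' =>
      let: existT E (g, r) := s in
      let: existT E' (g', r') := s' in
      exists e : hom E E', e \oc g = g' \oc b /\ cseq_mor e x r r'
  end.

(* For n >= 1, Ext^n(X, B) is the group of Yoneda n-extensions
   0 -> B -> E_n -> ... -> E_1 -> X -> 0 modulo the equivalence relation
   generated by the morphisms that are the identity on B and on X; this makes
   sense without enough projectives or injectives. *)
Definition yext (n : nat) (X B : A) : Type :=
  {s : cseq n B X | exact_cseq s}.

Definition yext_mor (n : nat) (X B : A) (s t : yext n X B) : Prop :=
  cseq_mor (idm B) (idm X) (sval s) (sval t).

Definition yext_eq (n : nat) (X B : A) : yext n X B -> yext n X B -> Prop :=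
  clos_refl_sym_trans _ (@yext_mor n X B).

(* Ext^n(X, B) = 0, n >= 1: the group has just one element. *)
Definition Ext_zero (n : nat) (X B : A) : Prop :=
  forall s t : yext n X B, yext_eq s t.

(* A full subcategory is given by its class of objects. *)
Definition subcat := A -> Prop.

Definition additive_subcat (P : subcat) : Prop :=
  (exists Z, zero_object Z /\ P Z) /\
  (forall X Y, P X -> P Y -> exists S, biproduct S X Y /\ P S).

Definition subcat_incl (P Q : subcat) : Prop := forall X, P X -> Q X.

Definition subcat_eq (P Q : subcat) : Prop := forall X, P X <-> Q X.

Definition closed_summands (P : subcat) : Prop :=
  forall S X Y, biproduct S X Y -> P S -> P X.

Definition Hom_exact (E : subcat) (X Y Z : A) (f : hom X Y) (g : hom Y Z) :
    Prop :=
  forall W, E W ->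
    [/\ forall u v : hom W X, f \oc u = f \oc v -> u = v,
        forall v : hom W Y, g \oc v = 0 <-> exists u : hom W X, v = f \oc u
      & forall w : hom W Z, exists v : hom W Y, w = g \oc v].

Definition proper_exact (E : subcat) (X Y Z : A) (f : hom X Y) (g : hom Y Z) :
    Prop :=
  short_exact f g /\ Hom_exact E f g.

Definition proper_generator (E C T : subcat) : Prop :=
  [/\ additive_subcat C, subcat_incl C T
    & forall X, T X -> exists (T' C0 : A) (f : hom T' C0) (g : hom C0 X),
        [/\ proper_exact E f g, C C0 & T T']].

Definition cogenerator (C T : subcat) : Prop :=
  [/\ additive_subcat C, subcat_incl C T
    & forall X, T X -> exists (C0 T' : A) (f : hom X C0) (g : hom C0 T'),
        [/\ short_exact f g, C C0 & T T']].

Definition preresolving (E T : subcat) : Prop :=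
  [/\ additive_subcat T,
      exists C, proper_generator E C T
    & forall (X Y Z : A) (f : hom X Y) (g : hom Y Z),
        proper_exact E f g -> T X -> T Z -> T Y].

Definition closed_proper_kernels (C T : subcat) : Prop :=
  forall (X Y Z : A) (f : hom X Y) (g : hom Y Z),
    proper_exact C f g -> T Y -> T Z -> T X.

Definition right_perp (P : subcat) : subcat :=
  fun X => forall W, P W -> forall i, (1 <= i)%N -> Ext_zero i W X.

Definition left_perp (P : subcat) : subcat :=
  fun X => forall W, P W -> forall i, (1 <= i)%N -> Ext_zero i X W.

(* All terms of B -> E_n -> ... -> E_1 -> X, except X, are in P. *)
Fixpoint terms_in (P : subcat) (n : nat) (B X : A) : cseq n B X -> Prop :=
  match n with
  | 0 => fun _ => P B
  | m.+1 => fun s => let: existT _ (_, r) := s in P B /\ terms_in P r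
  end.

(* There is an exact 0 -> P_n -> ... -> P_0 -> X -> 0 with all P_i in P. *)
Definition has_resolution (P : subcat) (X : A) (n : nat) : Prop :=
  exists (B : A) (s : cseq n B X), exact_cseq s /\ terms_in P s.

(* P-dim X, where [None] stands for infinity. *)
Definition dim (P : subcat) (X : A) : option nat :=
  match pselect (exists n, `[< has_resolution P X n >]) with
  | left h => Some (ex_minn h)
  | right _ => None
  end.

Definition finite_dim (P : subcat) : subcat := fun X => dim P X <> None.

End Abelian.

Arguments subcat : clear implicits.

(* Main.v *)
From mathcomp Require Import all_boot ssralg boolp.
Require Import Defs.

(* A T-resolution of X can be replaced by one of the same length n in which
   only the last syzygy L is in T and the other terms are in C; it remains to
   see that L may be taken in C.  If X has finite C-dimension, Schanuel's lemma
   shows that L has finite C-dimension too, so that Ext^1(L, -) vanishes on the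
   kernel of a C-cover of L and L is a summand of an object of C.  If C
   cogenerates T, pushouts along embeddings of L turn the resolution into
   0 -> K -> P -> X -> 0 with P in T and K of C-dimension less than n, and
   Ext^1(T, P) = 0 when X is in the right orthogonal of T, so that P is a
   summand of an object of C.

   The vanishing of Ext^1(T, N) for N of finite C-dimension requires dimension
   shifting for Yoneda Ext in an abelian category without enough projectives or
   injectives.  The relation [null] is an invariant of the Yoneda equivalence
   that holds for the zero class, and an extension which is null is the target
   of a morphism, identical on both ends, from one whose first map is split;
   dimension shifting in this last form only takes pushouts of extensions. *)

Set Implicit Arguments.
Unset Strict Implicit.
Unset Printing Implicit Defensive.

Import GRing.Theory.
Local Open Scope ring_scope.

(** * Additive calculus, kernels, cokernels and generalized elements *)

Section Preadditive.
Variable A : preadditiveCategory.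
Implicit Types B C D E F K L M N Q S W X Y Z : A.

Lemma comp0m X Y Z (f : hom X Y) : (0 : hom Y Z) \oc f = 0.
Proof. by apply: (addrI (0 \oc f)); rewrite -compDl !addr0. Qed.

Lemma compm0 X Y Z (g : hom Y Z) : g \oc (0 : hom X Y) = 0.
Proof. by apply: (addrI (g \oc 0)); rewrite -compDr !addr0. Qed.

Lemma compNm X Y Z (g : hom Y Z) (f : hom X Y) : (- g) \oc f = - (g \oc f).
Proof. by apply: (addrI (g \oc f)); rewrite -compDl !subrr comp0m. Qed.

Lemma compmN X Y Z (g : hom Y Z) (f : hom X Y) : g \oc (- f) = - (g \oc f).
Proof. by apply: (addrI (g \oc f)); rewrite -compDr !subrr compm0. Qed.

Lemma compBl X Y Z (g g' : hom Y Z) (f : hom X Y) :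
  (g - g') \oc f = g \oc f - g' \oc f.
Proof. by rewrite compDl compNm. Qed.

Lemma compBr X Y Z (g : hom Y Z) (f f' : hom X Y) :
  g \oc (f - f') = g \oc f - g \oc f'.
Proof. by rewrite compDr compmN. Qed.

Lemma mono0P X Y (f : hom X Y) :
  (forall W (x : hom W X), f \oc x = 0 -> x = 0) <-> mono f.
Proof.
split=> [h W x y e|h W x e].
  by apply/subr0_eq/h; rewrite compBr e subrr.
by apply: h; rewrite compm0.
Qed.

Lemma epi0P X Y (f : hom X Y) :
  (forall W (x : hom Y W), x \oc f = 0 -> x = 0) <-> epi f.
Proof.
split=> [h W x y e|h W x e].
  by apply/subr0_eq/h; rewrite compBl e subrr.
by apply: h; rewrite comp0m.
Qed.

Lemma epi0 X Y W (f : hom X Y) (x : hom Y W) : epi f -> x \oc f = 0 -> x = 0.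
Proof. by move=> /epi0P; apply. Qed.

Lemma mono0 X Y W (f : hom X Y) (x : hom W X) : mono f -> f \oc x = 0 -> x = 0.
Proof. by move=> /mono0P; apply. Qed.

Lemma mono_id X : mono (idm X).
Proof. by move=> W x y; rewrite !comp1m. Qed.

Lemma epi_id X : epi (idm X).
Proof. by move=> W x y; rewrite !compm1. Qed.

Lemma mono_comp X Y Z (g : hom Y Z) (f : hom X Y) :
  mono g -> mono f -> mono (g \oc f).
Proof. by move=> mg mf W x y; rewrite -!compA => /mg/mf. Qed.

Lemma epi_comp X Y Z (g : hom Y Z) (f : hom X Y) :
  epi g -> epi f -> epi (g \oc f).
Proof. by move=> eg ef W x y; rewrite !compA => /ef/eg. Qed.

Lemma mono_cancel X Y Z (g : hom Y Z) (f : hom X Y) : mono (g \oc f) -> mono f.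
Proof. by move=> m W x y e; apply: m; rewrite -!compA e. Qed.

Lemma epi_cancel X Y Z (g : hom Y Z) (f : hom X Y) : epi (g \oc f) -> epi g.
Proof. by move=> m W x y e; apply: m; rewrite !compA e. Qed.

Lemma zero_to Z X (f : hom X Z) : zero_object Z -> f = 0.
Proof. by move=> hZ; exact: (hZ X).1. Qed.

Lemma zero_from Z X (f : hom Z X) : zero_object Z -> f = 0.
Proof. by move=> hZ; exact: (hZ X).2. Qed.

Lemma zero_mono Z X (f : hom Z X) : zero_object Z -> mono f.
Proof. by move=> hZ; apply/mono0P => W x _; exact: zero_to. Qed.

Lemma zero_epi Z X (f : hom X Z) : zero_object Z -> epi f.
Proof. by move=> hZ; apply/epi0P => W x _; exact: zero_from. Qed.

Lemma biproductC S X Y : biproduct S X Y -> biproduct S Y X.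
Proof.
by move=> [i1 [i2 [p1 [p2 [h1 h2 h3 h4 h5]]]]]; exists i2, i1, p2, p1;
  split=> //; rewrite addrC.
Qed.

Lemma is_kernel_mono K X Y (k : hom K X) (f : hom X Y) : is_kernel k f -> mono k.
Proof.
move=> [fk u] W x y e.
have [|z [_ zu]] := u _ (k \oc x); first by rewrite compA fk comp0m.
by rewrite -(zu x) // -(zu y).
Qed.

Lemma is_kernel_lift K X Y W (k : hom K X) (f : hom X Y) (x : hom W X) :
  is_kernel k f -> f \oc x = 0 -> exists u, x = k \oc u.
Proof. by move=> [_ h] /h [u [<- _]]; exists u. Qed.

Lemma is_cokernel_epi Q X Y (q : hom Y Q) (f : hom X Y) :
  is_cokernel q f -> epi q.
Proof.
move=> [fk u] W x y e.
have [|z [_ zu]] := u _ (x \oc q); first by rewrite -compA fk compm0.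
by rewrite -(zu x) // -(zu y).
Qed.

Lemma is_cokernel_desc Q X Y W (q : hom Y Q) (f : hom X Y) (x : hom Y W) :
  is_cokernel q f -> x \oc f = 0 -> exists u, x = u \oc q.
Proof. by move=> [_ h] /h [u [<- _]]; exists u. Qed.

Lemma is_kernelI K X Y (k : hom K X) (f : hom X Y) :
  mono k -> f \oc k = 0 ->
  (forall W (x : hom W X), f \oc x = 0 -> exists u, x = k \oc u) ->
  is_kernel k f.
Proof.
move=> mk fk l; split=> // W x /l [u ->]; exists u; split=> // u' /mk.
by move->.
Qed.

(* Membership of the generalized element [x] in the image of [f]: the working
   substitute for elements in diagram chases. *)
Definition in_image X Y W (f : hom X Y) (x : hom W Y) : Prop :=
  exists (W' : A) (c : hom W' W) (x' : hom W' X), epi c /\ x \oc c = f \oc x'.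

Lemma in_imageT X Y W (f : hom X Y) (x : hom W X) : in_image f (f \oc x).
Proof. by exists W, (idm W), x; rewrite compm1; split=> //; exact: epi_id. Qed.

Lemma in_image_cover X Y W W' (f : hom X Y) (x : hom W Y) (c : hom W' W) :
  epi c -> in_image f (x \oc c) -> in_image f x.
Proof.
move=> ec [W2 [d [x' [ed e]]]]; exists W2, (c \oc d), x'.
by rewrite compA; split=> //; apply: epi_comp.
Qed.

(** The kernel of [g] lies in that of [c]: the condition under which the pushout of [g] along [c] is
    mono. *)
Definition kills X Y Z (g : hom X Y) (c : hom X Z) : Prop :=
  forall W (x : hom W X), g \oc x = 0 -> c \oc x = 0.

Lemma mono_kills X Y Z (g : hom X Y) (c : hom X Z) : mono g -> kills g c.
Proof. by move=> /mono0P m W x /m ->; rewrite compm0. Qed.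

End Preadditive.

(** * Images, pullbacks, pushouts and exactness in an abelian category *)

Section Abelian.
Variables (A : preadditiveCategory) (hA : abelian A).
Implicit Types B C D E F K L M N Q S W X Y Z : A.

Lemma zero_ex : exists Z : A, zero_object Z.
Proof. by case: hA. Qed.

Lemma biproduct_ex X Y : exists S, biproduct S X Y.
Proof. by case: hA => _ []. Qed.

Lemma kernel_ex X Y (f : hom X Y) : exists K (k : hom K X), is_kernel k f.
Proof. by case: hA => _ [_ []]. Qed.

Lemma cokernel_ex X Y (f : hom X Y) : exists Q (q : hom Y Q), is_cokernel q f.
Proof. by case: hA => _ [_ [_ []]]. Qed.

Lemma mono_kernel X Y (f : hom X Y) :
  mono f -> exists Z (g : hom Y Z), is_kernel f g.
Proof. by case: hA => _ [_ [_ [_ []]]] h _; exact: h. Qed.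

Lemma epi_cokernel X Y (f : hom X Y) :
  epi f -> exists W (g : hom W X), is_cokernel f g.
Proof. by case: hA => _ [_ [_ [_ []]]] _ h; exact: h. Qed.

Lemma epi_desc X Y Z (g : hom X Y) (c : hom X Z) :
  epi g -> kills g c -> exists u, c = u \oc g.
Proof.
move=> /epi_cokernel [W [k [gk gu]]] h.
by apply: is_cokernel_desc; [split; [exact: gk|exact: gu]|exact: h].
Qed.

Lemma mono_lift X Y W W' (f : hom X Y) (x : hom W Y) (c : hom W' W) x' :
  mono f -> epi c -> x \oc c = f \oc x' -> exists u, x = f \oc u.
Proof.
move=> /mono_kernel [Z [h k]] ec e.
apply: (is_kernel_lift k); apply: (epi0 ec).
by rewrite -compA e compA k.1 comp0m.
Qed.

Lemma mono_in_image X Y W (f : hom X Y) (x : hom W Y) :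
  mono f -> in_image f x -> exists u, x = f \oc u.
Proof. by move=> mf [W' [c [x' [ec e]]]]; exact: mono_lift mf ec e. Qed.

(** If h e = 0 and [k] is the kernel of [h], then [f] factors through the mono m k, a kernel of some
    [z]. Since z f = 0, [z] factors through [q], so z m = 0 and [m] factors through m k. Hence [k]
    has a right inverse and h = 0. *)
Lemma image_factor X Y Q (f : hom X Y) (q : hom Y Q) I (m : hom I Y) :
  is_cokernel q f -> is_kernel m q -> exists e, f = m \oc e /\ epi e.
Proof.
move=> cq km; have [e fe] := is_kernel_lift km cq.1.
exists e; split=> //; apply/epi0P => W h he.
have [K [k kk]] := kernel_ex h.
have [e' ee'] := is_kernel_lift kk he.
have mm := is_kernel_mono km; have mk := is_kernel_mono kk.
have [Z [z kz]] := mono_kernel (mono_comp mm mk).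
have [|z' zz'] := @is_cokernel_desc _ _ _ _ _ q f z cq.
  by rewrite fe ee' (compA m) compA kz.1 comp0m.
have [|l ml] := @is_kernel_lift _ _ _ _ _ _ z m kz.
  by rewrite zz' -compA km.1 compm0.
have kl : k \oc l = idm I by apply: mm; rewrite compA -ml compm1.
by rewrite -(compm1 h) -kl compA kk.1 comp0m.
Qed.

(** The kernel of [d] on a biproduct. If [f] is epi, so is [d], because d i1 = f; a map [h]
    vanishing on the second projection then satisfies h q2 = w d, and restricting to X gives w f =
    0. *)
Lemma pullback_ex X Y Z (f : hom X Z) (g : hom Y Z) :
  exists P (p1 : hom P X) (p2 : hom P Y),
  [/\ f \oc p1 = g \oc p2,
      forall W (x : hom W X) (y : hom W Y), f \oc x = g \oc y ->
        exists u, p1 \oc u = x /\ p2 \oc u = y,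
      forall W (u v : hom W P),
        p1 \oc u = p1 \oc v -> p2 \oc u = p2 \oc v -> u = v
    & epi f -> epi p2].
Proof.
have [S [i1 [i2 [q1 [q2 [h1 h2 h3 h4 h5]]]]]] := biproduct_ex X Y.
pose d := f \oc q1 - g \oc q2.
have [P [k kk]] := kernel_ex d; have mk := is_kernel_mono kk.
exists P, (q1 \oc k), (q2 \oc k); split.
- by apply/subr0_eq; rewrite !compA -compBl kk.1.
- move=> W x y e; have [|u ku] := @is_kernel_lift _ _ _ _ _ k d
    (i1 \oc x + i2 \oc y) kk.
    rewrite /d compBl !compDr -!compA (compA q1) h1 (compA q1) h3 (compA q2) h4.
    by rewrite (compA q2) h2 !comp1m !comp0m !compm0 addr0 add0r e subrr.
  exists u; rewrite -!compA -ku !compDr !compA h1 h2 h3 h4.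
  by rewrite !comp1m !comp0m addr0 add0r.
- move=> W u v e1 e2; apply: mk.
  by rewrite -(comp1m k) -h5 !compDl -!compA !(compA q1) !(compA q2) e1 e2.
move=> ef; apply/epi0P => W h; rewrite compA => hk.
have ed : epi d.
  apply: (@epi_cancel _ _ _ _ _ i1).
  by rewrite /d compBl -!compA h1 h4 compm0 subr0 compm1.
have [|w hw] := @epi_desc _ _ _ d (h \oc q2) ed.
  by move=> V x /(is_kernel_lift kk) [u ->]; rewrite compA hk comp0m.
have w0 : w = 0.
  apply: (epi0 ef).
  have : h \oc q2 \oc i1 = w \oc d \oc i1 by rewrite hw.
  by rewrite -!compA h4 compm0 /d compBl -!compA h1 h4 compm0 subr0 compm1.
by rewrite -(compm1 h) -h2 compA hw w0 !comp0m.
Qed.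

Lemma epi_lift X Y W (f : hom X Y) (x : hom W Y) : epi f -> in_image f x.
Proof.
move=> ef; have [P [p1 [p2 [e _ _ ep]]]] := pullback_ex f x.
by exists P, p2, p1; split; [exact: ep|rewrite e].
Qed.

Lemma epi_in_imageP X Y (f : hom X Y) :
  (forall W (x : hom W Y), in_image f x) -> epi f.
Proof.
move=> /(_ _ (idm Y)) [W [c [x [ec]]]]; rewrite comp1m => e.
by apply: (@epi_cancel _ _ _ _ f x); rewrite -e.
Qed.

Lemma cokernel_image X Y Q W (f : hom X Y) (q : hom Y Q) (x : hom W Y) :
  is_cokernel q f -> q \oc x = 0 -> in_image f x.
Proof.
move=> cq e; have [I [m km]] := kernel_ex q.
have [h [-> eh]] := image_factor cq km.
have [u ->] := is_kernel_lift km e.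
have [W' [c [x' [ec ex]]]] := @epi_lift _ _ _ _ u eh.
by exists W', c, x'; split=> //; rewrite -compA ex compA.
Qed.

Lemma exact_atP X Y Z (f : hom X Y) (g : hom Y Z) :
  exact_at f g <->
  g \oc f = 0 /\ forall W (x : hom W Y), g \oc x = 0 -> in_image f x.
Proof.
split=> [[I [m [[Q [q [cq km]]] kg]]]|[gf h]].
  split=> [|W x gx].
    by have [e [-> _]] := image_factor cq km; rewrite compA kg.1 comp0m.
  apply: (cokernel_image cq).
  by have [u ->] := is_kernel_lift kg gx; rewrite compA km.1 comp0m.
have [Q [q cq]] := cokernel_ex f; have [I [m km]] := kernel_ex q.
exists I, m; split; first by exists Q, q.
have [e [fe ee]] := image_factor cq km.
apply: is_kernelI; first exact: is_kernel_mono km.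
  by apply: (epi0 ee); rewrite -compA -fe.
move=> W x /h [W' [c [x' [ec ex]]]]; apply: (is_kernel_lift km).
by apply: (epi0 ec); rewrite -compA ex compA cq.1 comp0m.
Qed.

Lemma exact_comp0 X Y Z (f : hom X Y) (g : hom Y Z) :
  exact_at f g -> g \oc f = 0.
Proof. by case/exact_atP. Qed.

Lemma exact_lift X Y Z (f : hom X Y) (g : hom Y Z) W (x : hom W Y) :
  exact_at f g -> g \oc x = 0 -> in_image f x.
Proof. by case/exact_atP => _; apply. Qed.

Lemma short_exactI X Y Z (f : hom X Y) (g : hom Y Z) :
  mono f -> epi g -> g \oc f = 0 ->
  (forall W (x : hom W Y), g \oc x = 0 -> in_image f x) -> short_exact f g.
Proof. by move=> mf eg gf h; split=> //; apply/exact_atP. Qed.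

Lemma short_exact0 X Y Z (f : hom X Y) (g : hom Y Z) :
  short_exact f g -> g \oc f = 0.
Proof. by case=> _ /exact_comp0. Qed.

Lemma short_exact_lift X Y Z W (f : hom X Y) (g : hom Y Z) (x : hom W Y) :
  short_exact f g -> g \oc x = 0 -> exists u, x = f \oc u.
Proof. by move=> [mf ex _] gx; apply: (mono_in_image mf); exact: exact_lift gx. Qed.

Lemma short_exact_desc X Y Z W (f : hom X Y) (g : hom Y Z) (x : hom Y W) :
  short_exact f g -> x \oc f = 0 -> exists u, x = u \oc g.
Proof.
move=> s xf; have [mf ex eg] := s; apply: (epi_desc eg) => V y gy.
by have [u ->] := short_exact_lift s gy; rewrite compA xf comp0m.
Qed.

Lemma cokernel_short_exact X Y (f : hom X Y) :
  mono f -> exists Q (q : hom Y Q), short_exact f q.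
Proof.
move=> mf; have [Q [q cq]] := cokernel_ex f; exists Q, q.
apply: short_exactI => //; [exact: is_cokernel_epi cq|exact: cq.1|].
by move=> W x; exact: cokernel_image.
Qed.

Lemma short_exact_id0 Y Z : zero_object Z -> short_exact (idm Y) (0 : hom Y Z).
Proof.
move=> hZ; apply: short_exactI; [exact: mono_id| |by rewrite comp0m|].
  exact: zero_epi.
by move=> W x _; rewrite -(comp1m x); exact: in_imageT.
Qed.

(** The cokernel of (g, -c). The last two clauses describe its generalized elements: up to an epi
    cover each one is u e + j y, and such a sum vanishes only if it comes from B. *)
Lemma pushout_ex B E Y (g : hom B E) (c : hom B Y) :
  exists Q (u : hom E Q) (j : hom Y Q),
  [/\ u \oc g = j \oc c,
      forall Z (x : hom E Z) (y : hom Y Z), x \oc g = y \oc c ->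
        exists w, w \oc u = x /\ w \oc j = y,
      forall Z (v w : hom Q Z),
        v \oc u = w \oc u -> v \oc j = w \oc j -> v = w,
      forall W (x : hom W Q), exists W' (d : hom W' W) e y,
        epi d /\ x \oc d = u \oc e + j \oc y
    & forall W (x : hom W E) (y : hom W Y), u \oc x + j \oc y = 0 ->
        exists W' (d : hom W' W) b,
        [/\ epi d, x \oc d = g \oc b & y \oc d = - (c \oc b)]].
Proof.
have [S [i1 [i2 [q1 [q2 [h1 h2 h3 h4 h5]]]]]] := biproduct_ex E Y.
pose d := i1 \oc g - i2 \oc c.
have [Q [q cq]] := cokernel_ex d; have eq := is_cokernel_epi cq.
exists Q, (q \oc i1), (q \oc i2); split.
- by apply/subr0_eq; rewrite -!compA -compBr cq.1.
- move=> Z x y e; have [|w hw] := @is_cokernel_desc _ _ _ _ _ q d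
    (x \oc q1 + y \oc q2) cq.
    rewrite /d compBr !compDl !compA -(compA x q1 i1) h1 -(compA x q1 i2) h3.
    rewrite -(compA y q2 i1) h4 -(compA y q2 i2) h2.
    by rewrite !compm1 !compm0 !comp0m addr0 add0r e subrr.
  exists w; rewrite !compA -hw !compDl -!compA h1 h2 h3 h4.
  by rewrite !compm1 !compm0 addr0 add0r.
- move=> Z v w e1 e2; apply: eq.
  by rewrite -(compm1 q) -h5 compDr (compA q i1) (compA q i2) !compDr
    !(compA _ (q \oc _)) e1 e2.
- move=> W x; have [W' [t [x' [et ex]]]] := @epi_lift _ _ _ _ x eq.
  exists W', t, (q1 \oc x'), (q2 \oc x'); split=> //.
  by rewrite ex -{1}(comp1m x') -h5 compDl compDr !compA.
move=> W x y; rewrite -!compA -compDr => /(cokernel_image cq).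
move=> [W' [t [b [et]]]]; rewrite /d compDl compBl -!compA => e.
exists W', t, b; split=> //.
  move/(congr1 (comp q1)): e.
  by rewrite compDr compBr !compA h1 h3 !comp1m !comp0m addr0 subr0.
move/(congr1 (comp q2)): e.
by rewrite compDr compBr !compA h2 h4 !comp1m !comp0m !add0r.
Qed.

Lemma kills_pushout B E Y (g : hom B E) (c : hom B Y) :
  kills g c -> exists Q (u : hom E Q) (j : hom Y Q),
    mono j /\ u \oc g = j \oc c.
Proof.
move=> gc; have [Q [u [j [ug _ _ _ ker]]]] := pushout_ex g c.
exists Q, u, j; split=> //; apply/mono0P => W y jy.
have [|W' [d [b [ed]]]] := ker W 0 y; first by rewrite compm0 add0r.
rewrite comp0m => gb yd; apply: (epi0 ed).
by rewrite yd gc ?oppr0.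
Qed.

Lemma short_exact_pushout B E Z Y (f : hom B E) (g : hom E Z) (c : hom B Y) :
  short_exact f g -> exists Q (u : hom E Q) (j : hom Y Q) (h : hom Q Z),
  [/\ short_exact j h, u \oc f = j \oc c, h \oc u = g, mono c -> mono u
    & forall V (x : hom E V) (y : hom Y V), x \oc f = y \oc c ->
        exists w, w \oc u = x /\ w \oc j = y].
Proof.
move=> s; have [mf _ eg] := s; have gf := short_exact0 s.
have [Q [u [j [uf univ _ gen ker]]]] := pushout_ex f c.
have [|h [hu hj]] := univ _ g (0 : hom Y Z); first by rewrite gf comp0m.
exists Q, u, j, h; split=> //.
  apply: short_exactI => //.
  - apply/mono0P => W y jy.
    have [|W' [d [b [ed]]]] := ker W 0 y; first by rewrite compm0 add0r.
    rewrite comp0m => /esym/(mono0 mf) -> yd; apply: (epi0 ed).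
    by rewrite yd compm0 oppr0.
  - by apply: (@epi_cancel _ _ _ _ _ u); rewrite hu.
  - move=> W x hx; have [W' [d [e [y [ed xd]]]]] := gen W x.
    have [|b eb] := @short_exact_lift _ _ _ _ f g e s.
      move/(congr1 (comp h)): xd.
      by rewrite compA hx comp0m compDr !compA hu hj comp0m addr0.
    exists W', d, (c \oc b + y); split=> //.
    by rewrite xd eb compDr !compA uf.
move=> mc; apply/mono0P => W e ue.
have [|W' [d [b [ed xd]]]] := ker W e 0; first by rewrite compm0 addr0.
rewrite comp0m => /eqP; rewrite eq_sym oppr_eq0 => /eqP /(mono0 mc) b0.
by apply: (epi0 ed); rewrite xd b0 compm0.
Qed.

Lemma short_exact_pullback K Y Z Z' (f : hom K Y) (g : hom Y Z) (h : hom Z' Z) :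
  short_exact f g -> exists P (f' : hom K P) (g' : hom P Z') (h' : hom P Y),
  [/\ short_exact f' g', g \oc h' = h \oc g', h' \oc f' = f,
      forall W (x : hom W Y) (y : hom W Z'), g \oc x = h \oc y ->
        exists u, h' \oc u = x /\ g' \oc u = y
    & forall W (u v : hom W P),
        h' \oc u = h' \oc v -> g' \oc u = g' \oc v -> u = v].
Proof.
move=> s; have [mf _ eg] := s; have gf := short_exact0 s.
have [P [h' [g' [e univ joint ep]]]] := pullback_ex g h.
have [|f' [f1 f2]] := univ _ f (0 : hom K Z'); first by rewrite gf compm0.
exists P, f', g', h'; split=> //; apply: short_exactI => //.
- by apply: (@mono_cancel _ _ _ _ h'); rewrite f1.
- exact: ep.
move=> W x gx; have [|k xk] := @short_exact_lift _ _ _ _ f g (h' \oc x) s.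
  by rewrite compA e -compA gx compm0.
suff -> : x = f' \oc k by exact: in_imageT.
by apply: joint; rewrite compA ?f1 ?f2 ?gx ?comp0m // xk.
Qed.

(** * Yoneda extensions *)

(** For [n] = 0 the next object is [X] itself, so that one argument with [next_obj], [first_map] and
    [rebase] serves both at an inner term and at the right end. *)
Definition next_obj n B X : cseq n B X -> A :=
  match n with
  | 0 => fun _ => X
  | m.+1 => fun s => projT1 s
  end.

Definition first_map n B X : forall s : cseq n B X, hom B (next_obj s) :=
  match n with
  | 0 => fun g => g
  | m.+1 => fun s => (projT2 s).1
  end.

Definition rebase n B X B' :
    forall s : cseq n B X, hom B' (next_obj s) -> cseq n B' X :=
  match n with
  | 0 => fun _ f => f
  | m.+1 => fun s f => existT _ (projT1 s) (f, (projT2 s).2)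
  end.

Lemma cseq_mor_id n B X (s : cseq n B X) : cseq_mor (idm B) (idm X) s s.
Proof.
elim: n B s => [|n IH] B; first by move=> /= g; rewrite comp1m compm1.
by move=> [E [g r]] /=; exists (idm E); rewrite comp1m compm1.
Qed.

Lemma cseq_mor_comp n B X B' B'' (b : hom B B') (b' : hom B' B'')
    (s : cseq n B X) (s' : cseq n B' X) (s'' : cseq n B'' X) :
  cseq_mor b (idm X) s s' -> cseq_mor b' (idm X) s' s'' ->
  cseq_mor (b' \oc b) (idm X) s s''.
Proof.
elim: n B B' B'' b b' s s' s'' => [|n IH] B B' B'' b b' /=.
  by move=> g g' g''; rewrite !comp1m => -> ->; rewrite compA.
move=> [E [g r]] [E' [g' r']] [E'' [g'' r'']] [e [eg er]] [e' [eg' er']].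
exists (e' \oc e); split; last exact: IH er er'.
by rewrite -compA eg !compA eg'.
Qed.

Lemma cseq_mor_rebase n B X B' (s : cseq n B X) (f : hom B' (next_obj s))
    (b : hom B B') :
  f \oc b = first_map s -> cseq_mor b (idm X) s (rebase f).
Proof.
case: n s f => [|n] /=; first by move=> g f ->; rewrite comp1m.
move=> [E [g r]] /= f fb; exists (idm E); rewrite comp1m fb.
by split=> //; exact: cseq_mor_id.
Qed.

Lemma rebase_cseq_mor n B X B' (s : cseq n B X) (f : hom B' (next_obj s))
    (b : hom B' B) :
  first_map s \oc b = f -> cseq_mor b (idm X) (rebase f) s.
Proof.
case: n s f => [|n] /=; first by move=> g f ->; rewrite comp1m.
move=> [E [g r]] /= f fb; exists (idm E); rewrite comp1m fb.
by split=> //; exact: cseq_mor_id.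
Qed.

(** Isolates the component [e] next to the left end; the rest of the morphism survives when the
    first maps are replaced by any pair compatible with [e]. *)
Lemma cseq_mor_next n B X B' (b : hom B B') (s : cseq n B X) (s' : cseq n B' X) :
  cseq_mor b (idm X) s s' ->
  exists e : hom (next_obj s) (next_obj s'),
    e \oc first_map s = first_map s' \oc b /\
    forall Y Y' (y : hom Y Y') (f : hom Y (next_obj s))
        (f' : hom Y' (next_obj s')),
      e \oc f = f' \oc y -> cseq_mor y (idm X) (rebase f) (rebase f').
Proof.
case: n s s' => [|n]; first by move=> g g' /= h; exists (idm X).
by move=> [E [g r]] [E' [g' r']] /= [e [eg er]]; exists e; split=> // *; exists e.
Qed.

Lemma rebase_first n B X (s : cseq n B X) : rebase (first_map s) = s.
Proof. by case: n s => //= n [E []]. Qed.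

(* [null s b] says that [b] pushes the class of [s] forward to zero.  The
   pushout of [s] along [b] is zero iff the class of the tail [r] of [s] dies
   along the map induced on cokernels by some [v : E -> Q] extending [b] over a
   monomorphism [Y -> Q]. *)
Fixpoint null n B X : cseq n B X -> forall Y, hom B Y -> Prop :=
  match n with
  | 0 => fun _ Y b => b = 0
  | m.+1 => fun s Y b => let: existT E (g, r) := s in
      exists Q M (y : hom Y Q) (q : hom Q M) (v : hom E Q),
        [/\ short_exact y q, v \oc g = y \oc b & null r (q \oc v)]
  end.

Lemma null_pullback n B X B' X' (b : hom B B') (x : hom X X')
    (s : cseq n B X) (s' : cseq n B' X') Y (c : hom B' Y) :
  cseq_mor b x s s' -> null s' c -> null s (c \oc b).
Proof.
elim: n B B' b s s' Y c => [|n IH] B B' b /=.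
  by move=> g g' Y c _ ->; exact: comp0m.
move=> [E [g r]] [E' [g' r']] Y c [e [eg er]] [Q [M [y [q [v [s vg nr]]]]]].
exists Q, M, y, q, (v \oc e); split=> //; last by rewrite compA; exact: IH er nr.
by rewrite -compA eg !compA vg.
Qed.

Lemma null0 n B X (s : cseq n B X) Y : null s (0 : hom B Y).
Proof.
have [Z hZ] := zero_ex.
elim: n B s Y => [|n IH] B // [E [g r]] Y /=.
exists Y, Z, (idm Y), 0, 0; split; first exact: short_exact_id0.
  by rewrite comp0m compm0.
by rewrite compm0; exact: IH.
Qed.

(** Pushing [y] out along [c] keeps the cokernel [M], and the map q v on the tail does not
    change. *)
Lemma null_compl n B X (s : cseq n B X) Y Y' (b : hom B Y) (c : hom Y Y') :
  null s b -> null s (c \oc b).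
Proof.
elim: n B s Y Y' b c => [|n IH] B /=; first by move=> g Y Y' b c ->; exact: compm0.
move=> [E [g r]] Y Y' b c [Q [M [y [q [v [s vg nr]]]]]].
have [Q' [u [j [h [s' uy hu _ _]]]]] := short_exact_pushout c s.
exists Q', M, j, h, (u \oc v); split=> //; last by rewrite compA hu.
by rewrite -compA vg !compA uy.
Qed.

(** Replacing [v] by v + y d does not alter q v. *)
Lemma null_addr n B X (s : cseq n.+1 B X) Y (b : hom B Y) d :
  null s b -> null s (b + d \oc first_map s).
Proof.
case: s d => [E [g r]] /= d [Q [M [y [q [v [s vg nr]]]]]].
exists Q, M, y, q, (v + y \oc d); split=> //.
  by rewrite compDl vg compDr compA.
by rewrite compDr compA (short_exact0 s) comp0m addr0.
Qed.

Lemma exact_after_first n W B X (h : hom W B) (s : cseq n B X) :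
  exact_after h s -> exact_at h (first_map s).
Proof. by case: n s => [|n] s /=; [case|case: s => E [g r] []]. Qed.

Lemma exact_kills W B X Y (h : hom W B) (g : hom B X) (c : hom B Y) :
  exact_at h g -> c \oc h = 0 -> kills g c.
Proof.
move=> ex ch V x /(exact_lift ex) [V' [d [w [ed e]]]].
by apply: (epi0 ed); rewrite -compA e compA ch comp0m.
Qed.

(* The two extensions of [c] obtained over [E] differ by a map [d] factoring
   through the tail of [s]; it is removed by correcting the extension over [E']
   when the tail ends at [X], and by enlarging [Q] otherwise. *)
Lemma null_pushforward n B X B' W W' (h : hom W B) (h' : hom W' B')
    (b : hom B B') (s : cseq n B X) (s' : cseq n B' X) Y (c : hom B' Y) :
  exact_after h s -> exact_after h' s' -> cseq_mor b (idm X) s s' ->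
  kills (first_map s') c -> null s (c \oc b) -> null s' c.
Proof.
elim: n W W' B B' h h' b s s' Y c => [|n IH] W W' B B' h h' b /=.
  move=> g g' Y c [_ eg] [_ eg']; rewrite comp1m => e kc cb.
  have [w cw] := epi_desc eg' kc.
  by move: cb; rewrite cw -compA -e => /(epi0 eg) ->; exact: comp0m.
move=> [E [g r]] [E' [g' r']] Y c /= [_ xr] [_ xr'] [e [eg er]] kc.
move=> [Q [M [y [q [v [s vg nr]]]]]]; have [my _ _] := s.
(* The last clause is asked for every [q'], because the cokernel of the enlarged mono j y is chosen
   only afterwards. *)
suff [Q2 [j [v' [mj vg' nv]]]] : exists Q2 (j : hom Q Q2) (v' : hom E' Q2),
    [/\ mono j, v' \oc g' = j \oc y \oc c
      & forall M' (q' : hom Q2 M') (m : hom M M'),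
          q' \oc j = m \oc q -> null r (q' \oc v' \oc e)].
  have [M' [q' s']] := cokernel_short_exact (mono_comp mj my).
  exists Q2, M', (j \oc y), q', v'; split=> //.
  have [|m qm] := @short_exact_desc _ _ _ _ y q (q' \oc j) s.
    by rewrite -compA (short_exact0 s').
  apply: (IH _ _ _ _ _ _ _ _ _ _ _ xr xr' er _ (nv _ _ _ qm)).
  apply: (exact_kills (exact_after_first xr')).
  by rewrite -compA vg' compA (short_exact0 s') comp0m.
have [|Q1 [v1 [j [mj v1g]]]] := @kills_pushout _ _ _ g' (y \oc c).
  by move=> V x /kc cx; rewrite -compA cx compm0.
pose d := v1 \oc e - j \oc v.
have dg : d \oc g = 0.
  by rewrite /d compBl -!compA eg vg (compA v1) v1g !compA subrr.
have kd := exact_kills (exact_after_first xr) dg.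
case: n => [|n] in r r' xr xr' er nr kd IH *.
  have [_ er1] := xr; have [_ er1'] := xr'.
  have [d1 dd] := epi_desc er1 kd.
  exists Q1, j, (v1 - d1 \oc r'); split=> //.
    by rewrite compBl v1g -(compA d1) (exact_comp0 (exact_after_first xr'))
               compm0 subr0 compA.
  move=> M' q' m qm; have -> : q' \oc (v1 - d1 \oc r') \oc e = m \oc (q \oc v).
    have -> : q' \oc (v1 - d1 \oc r') \oc e = q' \oc (v1 \oc e - d).
      by rewrite -compA compBl -(compA d1) -er comp1m dd.
    by rewrite /d opprB addrC subrK !compA qm.
  exact: null_compl.
have [Q2 [d2 [k [mk dk]]]] := kills_pushout kd.
exists Q2, (k \oc j), (k \oc v1); split; first exact: mono_comp.
  by rewrite -!compA v1g.
move=> M' q' m qm.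
have -> : q' \oc (k \oc v1) \oc e = m \oc (q \oc v) + (q' \oc d2) \oc first_map r.
  rewrite -(compA q' d2) dk -!compA !(compA m) -qm -!compA -!compDr.
  congr (_ \oc (_ \oc _)).
  by rewrite /d addrC subrK.
by apply: null_addr; exact: null_compl.
Qed.

(** * Changing the first map, pushouts of sequences, and the zero class *)

Lemma exact_after_change n W W' B X (h : hom W B) (h' : hom W' B)
    (s : cseq n B X) :
  exact_after h s -> exact_at h' (first_map s) -> exact_after h' s.
Proof. by case: n s => [|n] s /=; [case|case: s => E [g r] [_]]. Qed.

Lemma mono_exact0 B E (f : hom B E) : mono f -> exact_at (0 : hom B B) f.
Proof.
move=> mf; apply/exact_atP; split=> [|V x /(mono0 mf) ->]; first exact: compm0.
by rewrite -(compm0 V (0 : hom B B)); exact: in_imageT.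
Qed.

Lemma exact_cseqE n B X (s : cseq n B X) :
  exact_cseq s <-> exact_after (0 : hom B B) s /\ mono (first_map s).
Proof.
case: n s => [|n] /= s.
  by split=> [[ms es]|[[_ es] ms]]; split=> //; split=> //; exact: mono_exact0.
case: s => E [g r] /=; split=> [[mg xr]|[[_ xr] mg]] //.
by split=> //; split=> //; exact: mono_exact0.
Qed.

(** The last two hypotheses say that [f] and [first_map s] have the same image, so exactness further
    right is kept. *)
Lemma exact_after_rebase n W B X W' B' (h : hom W B) (h' : hom W' B')
    (s : cseq n B X) (f : hom B' (next_obj s)) :
  exact_after h s -> exact_at h' f ->
  (forall V (x : hom V B), in_image f (first_map s \oc x)) ->
  (forall V (x : hom V B'), in_image (first_map s) (f \oc x)) ->
  exact_after h' (rebase f).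
Proof.
case: n s f => [|n] /= s f.
  move=> [_ es] ex sf _; split=> //; apply: epi_in_imageP => V x.
  have [V' [d [y [ed e]]]] := epi_lift x es.
  by apply: (in_image_cover ed); rewrite e; exact: sf.
case: s f => [E [g r]] /= f [_ xr] ex gf fg; split=> //.
apply: (exact_after_change xr).
have /exact_atP [rg ker] := exact_after_first xr.
apply/exact_atP; split=> [|V x /ker [V' [d [y [ed e]]]]].
  have [V [d [y [ed e]]]] := fg _ (idm _); move: e; rewrite compm1 => e.
  by apply: (epi0 ed); rewrite -compA e compA rg comp0m.
by apply: (in_image_cover ed); rewrite e; exact: gf.
Qed.

Lemma cseq_pushout n B E X Y (g : hom B E) (r : cseq n E X) (c : hom B Y) :
  exact_after g r -> kills g c ->
  exists E' (j : hom Y E') (u : hom E E') (r' : cseq n E' X),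
  [/\ mono j /\ exact_after j r',
      u \oc g = j \oc c,
      cseq_mor u (idm X) r r',
      forall Z (k : hom E Z) (z : hom Y Z), k \oc g = z \oc c ->
        exists w, w \oc u = k /\ w \oc j = z
    & forall E'' (g'' : hom Y E'') (r'' : cseq n E'' X) (e : hom E E''),
        first_map r'' \oc g'' = 0 -> e \oc g = g'' \oc c ->
        cseq_mor e (idm X) r r'' ->
        exists w, w \oc j = g'' /\ cseq_mor w (idm X) r' r''].
Proof.
move=> xr kc; have xg := exact_after_first xr.
have [E' [u [j [ug univ joint gen ker]]]] := pushout_ex g c.
have [|p [pu pj]] := univ _ (first_map r) (0 : hom Y _).
  by rewrite (exact_comp0 xg) comp0m.
exists E', j, u, (rebase p); split=> //.
- split.
    apply/mono0P => V y jy.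
    have [|V' [d [b [ed]]]] := ker V 0 y; first by rewrite compm0 add0r.
    by rewrite comp0m => gb yd; apply: (epi0 ed); rewrite yd kc ?oppr0.
  apply: (exact_after_rebase xr).
  + apply/exact_atP; split=> // V x px.
    have [V' [d [e [y [ed xd]]]]] := gen V x.
    have [|V2 [d' [b [ed' eb]]]] := @exact_lift _ _ _ _ _ _ e xg.
      move/(congr1 (comp p)): xd.
      by rewrite compA px comp0m compDr !compA pu pj comp0m addr0.
    exists V2, (d \oc d'), (c \oc b + y \oc d'); split; first exact: epi_comp.
    by rewrite compA xd compDl -compA eb !compA ug compDr !compA.
  + by move=> V x; rewrite -pu -compA; exact: in_imageT.
  move=> V x; have [V' [d [e [y [ed xd]]]]] := gen V x.
  apply: (in_image_cover ed); rewrite -compA xd compDr !compA pu pj comp0m addr0.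
  exact: in_imageT.
- exact: cseq_mor_rebase.
move=> E'' g'' r'' e rg eg er.
have [w [wu wj]] := univ _ e g'' eg; exists w; split=> //.
rewrite -[r'']rebase_first.
have [e1 [e1r mor]] := cseq_mor_next er; apply: mor.
by apply: joint; rewrite -compA -[in RHS]compA ?pu ?wu // pj wj rg compm0.
Qed.

(** All intermediate terms are zero except the last, which is [X] with its identity. *)
Lemma exact_after_ex n W B X (g : hom W B) :
  epi g -> exists r : cseq n.+1 B X, exact_after g r.
Proof.
have [Z hZ] := zero_ex.
elim: n W B g => [|n IH] W B g eg.
  exists (existT _ X (0 : hom B X, idm X)); split; last split.
  - apply/exact_atP; split=> [|V x _]; first exact: comp0m.
    exact: epi_lift.
  - apply/exact_atP; split=> [|V x]; first exact: compm0.
    by rewrite comp1m => ->; rewrite -(compm0 V (0 : hom B X)); exact: in_imageT.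
  - exact: epi_id.
have [r xr] := IH B Z 0 (zero_epi hZ).
exists (existT _ Z (0 : hom B Z, r)); split=> //.
by apply/exact_atP; split=> [|V x _]; [exact: comp0m|exact: epi_lift].
Qed.

(** The zero class: a biproduct in degree one; in higher degrees, the identities of [B] and [X]
    joined by zero maps. *)
Lemma null_yext_ex n X B : exists s : yext n.+1 X B, null (sval s) (idm B).
Proof.
have [Z hZ] := zero_ex; have sB := short_exact_id0 B hZ.
case: n => [|n].
  have [S [i1 [i2 [p1 [p2 [h1 h2 h3 h4 h5]]]]]] := biproduct_ex B X.
  pose s : cseq 1 B X := existT _ S (i1, p2).
  have xs : exact_cseq s.
    split; last split.
    - by apply: (@mono_cancel _ _ _ _ p1); rewrite h1; exact: mono_id.
    - apply/exact_atP; split=> // V x px.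
      rewrite -(comp1m x) -h5 compDl -!compA px compm0 addr0.
      exact: in_imageT.
    by apply: (@epi_cancel _ _ _ _ _ i2); rewrite h2; exact: epi_id.
  exists (exist _ s xs) => /=; exists B, Z, (idm B), 0, p1; split=> //.
    by rewrite h1 comp1m.
  by rewrite comp0m.
have [r xr] := exact_after_ex n X (@epi_id _ B).
pose s : cseq n.+2 B X := existT _ B (idm B, r).
have xs : exact_cseq s by split=> //; exact: mono_id.
exists (exist _ s xs); exists B, Z, (idm B), 0, (idm B); split=> //.
by rewrite comp0m; exact: null0.
Qed.

(** Along one morphism, nullity passes from target to source by [null_pullback] and from source to
    target by [null_pushforward], where exactness enters. *)
Lemma yext_null n X B (s t : yext n X B) :
  yext_eq s t -> null (sval s) (idm B) <-> null (sval t) (idm B).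
Proof.
elim=> {s t} [[s xs] [t xt] m|//|s t _ [] //|s t u _ [h1 h2] _ [h3 h4]]; last first.
  by split=> [/h1/h3|/h4/h2].
have {}m : cseq_mor (idm B) (idm X) s t := m.
split=> /= h; last by rewrite -(comp1m (idm B)); exact: null_pullback m h.
have [xs' _] := (exact_cseqE _).1 xs; have [xt' mt] := (exact_cseqE _).1 xt.
apply: (null_pushforward xs' xt' m (mono_kills _ mt)).
by rewrite comp1m.
Qed.

(** Some sequence mapping to [s], identically on both ends, has a first map [g] through which [c]
    factors. Its kernel is that of the first map of [s], which need not be mono. For [c] an
    identity, [g] is split. *)
Definition coboundary n B X (s : cseq n.+1 B X) Y (c : hom B Y) : Prop :=
  exists F (g : hom B F) (r : cseq n F X) (k : hom F Y),
  [/\ exact_after g r, kills (first_map s) g, k \oc g = c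
    & cseq_mor (idm B) (idm X) (existT _ F (g, r) : cseq n.+1 B X) s].

Lemma null_coboundary n B X E (g : hom B E) (r : cseq n E X) Y (c : hom B Y) :
  exact_after g r -> kills g c ->
  null (existT _ E (g, r) : cseq n.+1 B X) c ->
  coboundary (existT _ E (g, r) : cseq n.+1 B X) c.
Proof.
elim: n B E g r Y c => [|n IH] B E g r Y c xr kc [Q [M [y [q [v [s vg nr]]]]]].
  have [v1 vv1] := short_exact_lift s nr.
  exists E, g, r, v1; split=> //; last exact: cseq_mor_id.
  have [my _ _] := s; apply: my.
  by rewrite compA -vv1.
case: r xr nr => E2 [g2 r2] xr nr.
have xg : exact_at g g2 := exact_after_first xr; have [_ xr2] := xr.
have [|F [gt [rt [k [xt gtg kgt [f []]]]]]] := IH _ _ _ _ _ (q \oc v) xr2 _ nr.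
  apply: (exact_kills xg).
  by rewrite -compA vg compA (short_exact0 s) comp0m.
rewrite compm1 => fgt ft.
have [my _ eq] := s; have qy := short_exact0 s.
(* The new sequence starts B -> S -> P, where P is the fibre product of Q and F over M, S is E + Y,
   and the first map [g'] is (g, -c), so that [- p2] recovers [c]. The map [w] has components v p1 +
   y p2 and gt p1. *)
have [P [b [a [qb univ joint ea]]]] := pullback_ex q k.
have {}ea := ea eq.
have [S [i1 [i2 [p1 [p2 [h1 h2 h3 h4 h5]]]]]] := biproduct_ex E Y.
have [|w [bw aw]] := univ _ (v \oc p1 + y \oc p2) (gt \oc p1).
  by rewrite compDr !compA qy comp0m addr0 kgt.
pose rP : cseq n P X := rebase (first_map rt \oc a).
pose g' := i1 \oc g - i2 \oc c.
have p1g : p1 \oc g' = g.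
  by rewrite compBr !compA h1 h3 comp0m subr0 comp1m.
have p2g : p2 \oc g' = - c.
  by rewrite compBr !compA h2 h4 comp0m sub0r comp1m.
exists S, g', (existT _ P (w, rP)), (- p2).
have xgt := exact_after_first xt.
split; last first.
- exists p1; split; last exists (f \oc a); first by rewrite compm1.
  rewrite -compA aw compA fgt; split=> //.
  apply: (cseq_mor_comp _ ft).
  exact: rebase_cseq_mor.
- by rewrite compNm p2g opprK.
- by move=> V x /= gx; rewrite /g' compBl -!compA gx kc // !compm0 subrr.
split.
  apply/exact_atP; split=> [|V x wx].
    apply: joint; rewrite compm0 compA.
      by rewrite bw compDl -!compA p1g p2g vg compmN subrr.
    rewrite aw -compA p1g; apply: gtg; exact: (exact_comp0 xg).
  have bwx : b \oc (w \oc x) = 0 by rewrite wx compm0.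
  have [|V' [d [z [ed e1]]]] := @exact_lift _ _ _ _ _ _ (p1 \oc x) xg.
    by rewrite -fgt -compA (compA gt) -aw -!compA wx !compm0.
  exists V', d, z; split=> //.
  have e2 : p2 \oc (x \oc d) = - (c \oc z).
    apply: my; move/(congr1 (fun u => u \oc d)): bwx.
    rewrite comp0m compA bw !compDl -!compA (compA p1) e1 compA vg => /eqP.
    by rewrite -compA addrC addr_eq0 compmN => /eqP.
  rewrite -(comp1m (x \oc d)) -h5 compDl -!compA e2 (compA p1) e1.
  by rewrite /g' compBl compmN !compA.
apply: (exact_after_rebase xt).
- apply/exact_atP; split=> [|V x].
    by rewrite -compA aw compA (exact_comp0 xgt) comp0m.
  rewrite -compA => /(exact_lift xgt) [V' [d [z [ed ez]]]].
  have [|u uy] := @short_exact_lift _ _ _ _ y q (b \oc x \oc d - v \oc z) s.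
    by rewrite compBr !compA qb -(compA k) -(compA k) ez compA kgt subrr.
  exists V', d, (i1 \oc z + i2 \oc u); split=> //; apply: joint.
    rewrite compA [RHS]compA bw compDr compDl !compDl -!compA.
    rewrite !(compA p1) !(compA p2).
    rewrite h1 h2 h3 h4 !comp1m !comp0m !compm0 addr0 add0r -uy.
    by rewrite addrC compA subrK.
  rewrite compA ez [RHS]compA aw -compA compDr !compA h1 h3.
  by rewrite comp1m comp0m addr0.
- move=> V x; have [V' [d [z [ed ez]]]] := epi_lift x ea.
  exists V', d, z; split=> //.
  by rewrite -!compA ez.
by move=> V x; rewrite -compA; exact: in_imageT.
Qed.

(** The index is shifted: [n] stands for Ext^(n+1). Vanishing takes the form that every extension
    receives a morphism from one with split first map. *)
Definition Ext_splits n X B : Prop :=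
  forall s : cseq n.+1 B X, exact_cseq s -> coboundary s (idm B).

Lemma Ext_zero_splits n X B : Ext_zero n.+1 X B -> Ext_splits n X B.
Proof.
move=> h s xs; have [t nt] := null_yext_ex n X B.
have /yext_null [_ /(_ nt) /=] := h (exist _ s xs) t.
case: s xs => E [g r] [mg xr]; apply: null_coboundary xr _.
exact: mono_kills.
Qed.

Lemma Ext_splits_shift n X D1 D0 N (a : hom D1 D0) (p : hom D0 N) :
  short_exact a p -> Ext_splits n.+1 X D1 -> Ext_splits n X D0 ->
  Ext_splits n X N.
Proof.
move=> s v1 v0 [E [g r]] [mg xr]; have [ma xa ep] := s.
(* Splicing the given extension of [N] with D1 -> D0 -> N gives an extension of [D1], one degree
   higher, to which [v1] applies. *)
pose gp : cseq n.+1 D0 X := existT _ E (g \oc p, r).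
have [|F [gt [rt [k [xt gtg kgt [f []]]]]]] := v1 (existT _ D0 (a, gp)).
  split=> //; split.
    apply/exact_atP; split=> [|V x].
      by rewrite -compA (short_exact0 s) compm0.
    rewrite -compA => /(mono0 mg) /(short_exact_lift s) [u ->].
    exact: in_imageT.
  apply: (exact_after_change xr).
  have /exact_atP [rg ker] := exact_after_first xr.
  apply/exact_atP; split=> [|V x /ker [V' [d [y [ed e]]]]].
    by rewrite compA rg comp0m.
  apply: (in_image_cover ed); rewrite e.
  have [V2 [d' [z [ed' e']]]] := epi_lift y ep.
  by exists V2, d', z; split=> //; rewrite -compA e' compA.
rewrite compm1 => fgt mt.
case: rt xt mt => F' [h rt] [xg xt] [f' [fh mt]].
(* Correcting [f] by the retraction [k] makes it vanish on [gt], so the rest of the sequence can be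
   pushed out along [c] to an extension of [D0], to which [v0] applies. Pushing its split
   replacement out along [p] gives a split extension of [N] that maps to the given one. *)
pose c := f - a \oc k.
have pc : p \oc c = p \oc f.
  by rewrite /c compBr compA (short_exact0 s) comp0m subr0.
have [|G [j [u [r0 [[mj xj] uh mu _ univ]]]]] := @cseq_pushout _ _ _ _ _ h rt c xt.
  apply: (exact_kills xg).
  by rewrite /c compBl fgt -compA kgt compm1 subrr.
have [||w [wj mw]] := univ E (g \oc p) r f' _ _ mt.
- by rewrite compA (exact_comp0 (exact_after_first xr)) comp0m.
- by rewrite fh -!compA pc.
have [|F2 [g2 [r2 [k2 [x2 _ kg2 [f2 []]]]]]] := v0 (existT _ G (j, r0)).
  by split.
rewrite compm1 => fg2 mr2.
have [|G3 [j3 [u3 [r3 [[mj3 xj3] ug3 mu3 univ0 univ3]]]]] :=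
  @cseq_pushout _ _ _ _ _ g2 r2 p x2.
  apply: mono_kills; apply: (@mono_cancel _ _ _ _ k2).
  by rewrite kg2; exact: mono_id.
have [|k3 [_ k3j]] := univ0 N (p \oc k2) (idm N).
  by rewrite -compA kg2 compm1 comp1m.
have [|||w3 [w3j mw3]] := univ3 E g r (w \oc f2).
- exact: exact_comp0 (exact_after_first xr).
- by rewrite -compA fg2 wj.
- exact: cseq_mor_comp mr2 mw.
exists G3, j3, r3, k3; split=> //; first exact: mono_kills.
by exists w3; rewrite compm1.
Qed.

(** With [k] a retraction of [gt], the map 1 - gt k vanishes on [gt] and descends to a section of
    [rt], which [f] carries to one of [r]. *)
Lemma Ext_splits_section X B E (g : hom B E) (r : hom E X) :
  Ext_splits 0 X B -> short_exact g r -> exists t : hom X E, r \oc t = idm X.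
Proof.
move=> v [mg xg er].
have [|F [gt [rt [k [[xt et] _ kgt [f []]]]]]] := v (existT _ E (g, r)).
  by split.
rewrite comp1m compm1 => fgt rf.
have [|t tr] := @epi_desc _ _ _ rt (idm F - gt \oc k) et.
  apply: (exact_kills xt).
  by rewrite compBl comp1m -compA kgt compm1 subrr.
exists (f \oc t); rewrite compA -rf; apply: et.
by rewrite -compA -tr compBr compm1 compA (exact_comp0 xt) comp0m subr0 comp1m.
Qed.

Lemma Ext_splits_lift W K Y Z (k : hom K Y) (g : hom Y Z) (w : hom W Z) :
  short_exact k g -> Ext_splits 0 W K -> exists v, g \oc v = w.
Proof.
move=> s v; have [P [f' [g' [h' [s' e _ _ _]]]]] := short_exact_pullback w s.
have [t gt] := Ext_splits_section v s'.
by exists (h' \oc t); rewrite compA e -compA gt compm1.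
Qed.

(** * Split sequences, and kernels and cokernels of composites *)

Lemma short_exact_biproduct K Y Z (f : hom K Y) (g : hom Y Z) (t : hom Z Y) :
  short_exact f g -> g \oc t = idm Z -> biproduct Y K Z.
Proof.
move=> s gt; have [mf _ _] := s; have gf := short_exact0 s.
have [|p fp] := @short_exact_lift _ _ _ _ f g (idm Y - t \oc g) s.
  by rewrite compBr compA gt comp1m compm1 subrr.
exists f, t, p, g; split=> //; last by rewrite -fp subrK.
  by apply: mf; rewrite compA -fp compBl -compA gf compm0 subr0 comp1m compm1.
by apply: mf; rewrite compA -fp compBl -compA gt compm0 comp1m compm1 subrr.
Qed.

Lemma Ext_splits_biproduct K Y Z (f : hom K Y) (g : hom Y Z) :
  short_exact f g -> Ext_splits 0 Z K -> biproduct Y K Z.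
Proof.
move=> s v; have [t gt] := Ext_splits_section v s.
exact: short_exact_biproduct s gt.
Qed.

Lemma mono_epi_inverse X Y (f : hom X Y) :
  mono f -> epi f -> exists g, f \oc g = idm Y /\ g \oc f = idm X.
Proof.
move=> mf ef; have [g fg] := mono_in_image mf (epi_lift (idm Y) ef).
by exists g; split=> //; apply: mf; rewrite compA -fg comp1m compm1.
Qed.

(** [L] is the pullback of [e] along [a]. *)
Lemma short_exact_kernel_comp K Y Z B X (k : hom K Y) (e : hom Y Z)
    (a : hom B Z) (p : hom Z X) :
  short_exact k e -> short_exact a p ->
  exists L (l : hom L Y) (k' : hom K L) (e' : hom L B),
  [/\ short_exact l (p \oc e), short_exact k' e', e \oc l = a \oc e'
    & forall W (x : hom W Y) (y : hom W B), e \oc x = a \oc y ->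
        exists u, l \oc u = x /\ e' \oc u = y].
Proof.
move=> s s'; have [L [k' [e' [l [sL el _ univ joint]]]]] := short_exact_pullback a s.
have [_ _ ee] := s; have [ma _ ep] := s'.
exists L, l, k', e'; split=> //.
apply: short_exactI; last move=> W x.
- apply/mono0P => W x lx; apply: joint; rewrite compm0 //.
  by apply: (mono0 ma); rewrite compA -el -compA lx compm0.
- exact: epi_comp.
- by rewrite -compA el compA (short_exact0 s') comp0m.
rewrite -compA => /(short_exact_lift s') [y /univ [u [<- _]]].
exact: in_imageT.
Qed.

(** [Q] is the pushout of [i] along [p]. *)
Lemma short_exact_cokernel_comp K P X C Y (k : hom K P) (p : hom P X)
    (i : hom P C) (q : hom C Y) :
  short_exact k p -> short_exact i q ->
  exists Q (u : hom C Q) (j : hom X Q) (h : hom Q Y),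
  [/\ short_exact (i \oc k) u, short_exact j h, u \oc i = j \oc p & h \oc u = q].
Proof.
move=> s s'; have [Q [u [j [h [sQ ui hu _ _]]]]] := short_exact_pushout p s'.
have [mk _ ep] := s; have [mi _ eq] := s'; have [mj _ _] := sQ.
exists Q, u, j, h; split=> //.
apply: short_exactI; last move=> W x ux.
- exact: mono_comp.
- apply/epi0P => W z zu.
  have [|z' zh] := @short_exact_desc _ _ _ _ j h z sQ.
    by apply: (epi0 ep); rewrite -compA -ui compA zu comp0m.
  move: zu; rewrite zh -compA hu => /(epi0 eq) ->; exact: comp0m.
- by rewrite compA ui -compA (short_exact0 s) compm0.
have [|y xy] := @short_exact_lift _ _ _ _ i q x s'.
  by rewrite -hu -compA ux compm0.
have [|z yz] := @short_exact_lift _ _ _ _ k p y s.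
  by apply: (mono0 mj); rewrite compA -ui -compA -xy.
by rewrite xy yz compA; exact: in_imageT.
Qed.

(** * Resolutions *)

Definition iso_closed (P : subcat A) : Prop :=
  forall X Y (f : hom X Y), mono f -> epi f -> P X -> P Y.

(** The last syzygy has a class [R] of its own, so that resolutions by C ending in T can be
    expressed. *)
Fixpoint resolves (R P : subcat A) n X : Prop :=
  match n with
  | 0 => R X
  | m.+1 => exists K C (f : hom K C) (g : hom C X),
      [/\ short_exact f g, P C & resolves R P m K]
  end.

Lemma short_exact_comp_iso K Y X X' (f : hom K Y) (g : hom Y X) (h : hom X X') :
  mono h -> epi h -> short_exact f g -> short_exact f (h \oc g).
Proof.
move=> mh eh s; have [mf _ eg] := s; apply: short_exactI => //.
- exact: epi_comp.
- by rewrite -compA (short_exact0 s) compm0.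
move=> W x; rewrite -compA => /(mono0 mh) /(short_exact_lift s) [u ->].
exact: in_imageT.
Qed.

Lemma resolves_iso R P n : iso_closed R -> iso_closed (resolves R P n).
Proof.
case: n => [|n] // _ X Y f mf ef [K [C [k [g [s PC r]]]]].
by exists K, C, k, (f \oc g); split=> //; exact: short_exact_comp_iso.
Qed.

Lemma resolves_shift R P n X :
  resolves (resolves R P 1) P n X -> resolves R P n.+1 X.
Proof.
elim: n X => [|n IH] X // [K [C [k [g [s PC r]]]]].
by exists K, C, k, g; split=> //; exact: IH.
Qed.

Definition tail_in (P : subcat A) n B X : cseq n B X -> Prop :=
  match n with
  | 0 => fun _ => True
  | m.+1 => fun s => terms_in P (projT2 s).2
  end.

Lemma terms_inE P n B X (s : cseq n B X) : terms_in P s <-> P B /\ tail_in P s.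
Proof. by case: n s => [|n] s /=; [split=> [|[]]|case: s => E []]. Qed.

Lemma tail_in_rebase P n B X B' (s : cseq n B X) (f : hom B' (next_obj s)) :
  tail_in P s -> tail_in P (rebase f).
Proof. by case: n s f. Qed.

(** A [cseq] unfolds from the left, [resolves] from the right. The induction passes to the cokernel
    K of B -> E, enlarging the class [R] to [resolves R P 1]. *)
Lemma cseq_resolves R P n B X (s : cseq n B X) :
  iso_closed R -> exact_cseq s -> R B -> tail_in P s -> resolves R P n X.
Proof.
elim: n R B s => [|n IH] R B s iR /=.
  by move=> [ms es] RB _; exact: (iR _ _ s).
case: s => [E [g r]] /= [mg xr] RB /terms_inE [PE tr].
have [K [q s]] := cokernel_short_exact mg; have [_ _ eq] := s.
have xg := exact_after_first xr.
have [|p rp] := @short_exact_desc _ _ _ _ g q (first_map r) s.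
  exact: exact_comp0 xg.
have mp : mono p.
  apply/mono0P => V x px.
  have [V' [d [y [ed e]]]] := epi_lift x eq.
  apply: (epi0 ed); rewrite e; apply: (exact_kills xg (short_exact0 s)).
  by rewrite rp -compA -e compA px comp0m.
apply: resolves_shift.
apply: (IH _ K (rebase p)); [exact: resolves_iso| | |exact: tail_in_rebase].
- apply/exact_cseqE; split; last by case: (n) r p rp mp {IH xr tr xg}.
  apply: (exact_after_rebase xr); first exact: mono_exact0.
    by move=> V x; rewrite rp -compA; exact: in_imageT.
  move=> V x; have [V' [d [y [ed e]]]] := epi_lift x eq.
  by exists V', d, y; split=> //; rewrite rp -!compA e.
by exists B, E, g, q.
Qed.

Fixpoint cseq_snoc n B Y C X (f : hom Y C) (g : hom C X) :
    cseq n B Y -> cseq n.+1 B X :=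
  match n with
  | 0 => fun s => existT _ C (f \oc s, g)
  | m.+1 => fun s =>
      let: existT E (h, r) := s in existT _ E (h, cseq_snoc f g r)
  end.

Lemma exact_after_snoc n W B Y C X (h : hom W B) (f : hom Y C) (g : hom C X)
    (s : cseq n B Y) :
  short_exact f g -> exact_after h s -> exact_after h (cseq_snoc f g s).
Proof.
move=> fg; have [mf xf eg] := fg.
elim: n W B h s => [|n IH] W B h s /=; last first.
  by case: s => E [k r] /= [xk xr]; split=> //; exact: IH.
move=> [xs es]; split; last split=> //.
  apply/exact_atP; split=> [|V x].
    by rewrite -compA (exact_comp0 xs) compm0.
  by rewrite -compA => /(mono0 mf) /(exact_lift xs).
apply/exact_atP; split=> [|V x /(short_exact_lift fg) [u ->]].
  by rewrite compA (exact_comp0 xf) comp0m.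
have [V' [d [y [ed e]]]] := epi_lift u es.
by exists V', d, y; split=> //; rewrite -compA e compA.
Qed.

Lemma terms_in_snoc P n B Y C X (f : hom Y C) (g : hom C X) (s : cseq n B Y) :
  terms_in P s -> P C -> terms_in P (cseq_snoc f g s).
Proof.
move=> + PC; elim: n B s => [|n IH] B s //=.
by case: s => E [k r] /= [PB /IH].
Qed.

Lemma resolves_cseq R P n X :
  resolves R P n X ->
  exists B (s : cseq n B X), [/\ exact_cseq s, R B & tail_in P s].
Proof.
elim: n X => [|n IH] X /=.
  move=> RX; exists X, (idm X); split=> //.
  by split; [exact: mono_id|exact: epi_id].
move=> [K [C [f [g [s PC /IH [B [r [/exact_cseqE [xr mr] RB tr]]]]]]]].
have [mf _ _] := s.
exists B, (cseq_snoc f g r).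
split=> //; first (apply/(@exact_cseqE n.+1); split; first exact: exact_after_snoc).
  case: n {xr tr IH} r mr => [|n] r mr /=; first exact: mono_comp.
  by case: r mr => E [].
case: n {xr mr IH} r tr => [|n] //= [E [k r]] /= tr.
exact: terms_in_snoc.
Qed.

Lemma has_resolutionP P n X :
  iso_closed P -> has_resolution P X n <-> resolves P P n X.
Proof.
move=> iP; split=> [[B [s [xs /terms_inE [PB ts]]]]|].
  exact: cseq_resolves ts.
by move=> /resolves_cseq [B [s [xs PB ts]]]; exists B, s; rewrite terms_inE.
Qed.

Definition Ext_vanishes X B : Prop := forall n, Ext_splits n X B.

Lemma Ext_vanishes1 X B : Ext_vanishes X B -> Ext_splits 0 X B.
Proof. exact. Qed.

Lemma Ext_vanishes_resolves W R P n X :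
  (forall Y, R Y -> Ext_vanishes W Y) -> (forall Y, P Y -> Ext_vanishes W Y) ->
  resolves R P n X -> Ext_vanishes W X.
Proof.
move=> vR vP; elim: n X => [|n IH] X /=; first exact: vR.
move=> [K [C [f [g [s PC /IH vK]]]]] i.
by apply: Ext_splits_shift s _ _; [exact: vK|exact: vP].
Qed.

Lemma proper_exactI (E : subcat A) X Y Z (f : hom X Y) (g : hom Y Z) :
  short_exact f g ->
  (forall W, E W -> forall w : hom W Z, exists v, w = g \oc v) ->
  proper_exact E f g.
Proof.
move=> s l; have [mf _ _] := s; split=> // W EW; split; last exact: l.
  exact: mf.
move=> v; split=> [/(short_exact_lift s)//|[u ->]].
by rewrite compA (short_exact0 s) comp0m.
Qed.

Lemma closed_summands_iso (P : subcat A) : closed_summands P -> iso_closed P.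
Proof.
move=> hP X Y f mf ef; have [Z hZ] := zero_ex.
have [g [fg gf]] := mono_epi_inverse mf ef.
apply: (hP X Y Z); exists g, 0, f, 0.
rewrite fg !compm0 !comp0m addr0 gf; split=> //.
by rewrite (zero_to (idm Z)).
Qed.

(** [additive_subcat] provides one biproduct in [P]; any other is isomorphic to it. *)
Lemma biproduct_closed (P : subcat A) S X Y :
  additive_subcat P -> iso_closed P -> biproduct S X Y -> P X -> P Y -> P S.
Proof.
move=> [_ bP] iP [i1 [i2 [p1 [p2 [h1 h2 h3 h4 h5]]]]] PX PY.
have [S' [[j1 [j2 [q1 [q2 [k1 k2 k3 k4 k5]]]]] PS']] := bP X Y PX PY.
pose f := i1 \oc q1 + i2 \oc q2; pose g := j1 \oc p1 + j2 \oc p2.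
have fg : f \oc g = idm S.
  rewrite /f /g compDl !compDr -!compA !(compA q1) !(compA q2) k1 k2 k3 k4.
  by rewrite !comp1m !comp0m !compm0 addr0 add0r.
have gf : g \oc f = idm S'.
  rewrite /f /g compDl !compDr -!compA !(compA p1) !(compA p2) h1 h2 h3 h4.
  by rewrite !comp1m !comp0m !compm0 addr0 add0r.
apply: (iP _ _ f) PS'.
  by apply: (@mono_cancel _ _ _ _ g); rewrite gf; exact: mono_id.
by apply: (@epi_cancel _ _ _ _ _ g); rewrite fg; exact: epi_id.
Qed.

Lemma zero_short_exact Z X Y (f : hom X Y) :
  zero_object Z -> mono f -> epi f -> short_exact (0 : hom Z X) f.
Proof.
move=> hZ mf ef; apply: short_exactI => //; last move=> W x.
- exact: zero_mono.
- exact: compm0.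
by move=> /(mono0 mf) ->; rewrite -(compm0 W (0 : hom Z X)); exact: in_imageT.
Qed.

Lemma zero_closed (P : subcat A) Z :
  additive_subcat P -> iso_closed P -> zero_object Z -> P Z.
Proof.
move=> [[Z' [hZ' PZ']] _] iP hZ; apply: (iP _ _ (0 : hom Z' Z)) PZ'.
  exact: zero_mono.
exact: zero_epi.
Qed.

(** The last syzygy is covered by its own identity, with zero kernel. *)
Lemma resolves_pad (P : subcat A) n X :
  additive_subcat P -> iso_closed P -> resolves P P n X -> resolves P P n.+1 X.
Proof.
move=> aP iP; elim: n X => [|n IH] X.
  move=> PX; have [Z hZ] := zero_ex; exists Z, X, 0, (idm X).
  split=> //; last exact: zero_closed hZ.
  by apply: zero_short_exact hZ _ _; [exact: mono_id|exact: epi_id].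
by move=> [K [D [f [g [s PD /IH r]]]]]; exists K, D, f, g.
Qed.

(** * Comparison of resolutions by T and by C *)

Section Dimension.
Variables (E T C : subcat A).
Hypotheses (hT : preresolving E T) (hC : proper_generator E C T).
Hypothesis hperp : forall X : A, T X -> right_perp C X /\ left_perp C X.
Hypothesis hsum : closed_summands C.

Lemma C_additive : additive_subcat C. Proof. by case: hC. Qed.
Lemma T_additive : additive_subcat T. Proof. by case: hT. Qed.
Lemma CT X : C X -> T X. Proof. by case: hC => _ h _; exact: h. Qed.
Lemma C_iso : iso_closed C. Proof. exact: closed_summands_iso. Qed.

(** An isomorphism X -> Y makes Y an [E]-proper extension of a zero object by X. *)
Lemma T_iso : iso_closed T.
Proof.
have [aT _ xT] := hT; have [[Z [hZ TZ]] _] := aT.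
move=> X Y f mf ef TX; apply: (xT _ _ _ f (0 : hom Y Z)) => //.
apply: proper_exactI; last first.
  by move=> W _ w; exists 0; rewrite (zero_to w) // [RHS]zero_to.
apply: short_exactI => //.
- exact: zero_epi.
- exact: comp0m.
by move=> W x _; exact: epi_lift.
Qed.

Lemma Ext_vanishes_TC W D : T W -> C D -> Ext_vanishes W D.
Proof. by move=> /hperp [_ h] CD n; apply: Ext_zero_splits; exact: h. Qed.

Lemma Ext_vanishes_CT W D : C W -> T D -> Ext_vanishes W D.
Proof. by move=> CW /hperp [h _] n; apply: Ext_zero_splits; exact: h. Qed.

Lemma Ext_vanishes_T W n X : T W -> resolves C C n X -> Ext_vanishes W X.
Proof. by move=> TW; apply: Ext_vanishes_resolves => D; exact: Ext_vanishes_TC. Qed.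

Lemma Ext_vanishes_C W n X : C W -> resolves T C n X -> Ext_vanishes W X.
Proof.
move=> CW; apply: Ext_vanishes_resolves => D; first exact: Ext_vanishes_CT.
by move=> /CT; exact: Ext_vanishes_CT.
Qed.

(** Pulling K -> L -> X back along T1 -> X gives an [E]-proper extension P of T1 by K, hence P in T;
    it covers L with the same kernel K' as T1 -> X. *)
Lemma resolves_proper n K L X (k : hom K L) (e : hom L X) :
  proper_exact E k e -> T K -> resolves T T n X -> resolves T T n L.
Proof.
have [_ _ xT] := hT.
case: n => [|n] pe TK /=; first exact: xT pe TK.
move=> [K' [T1 [a [p [s' TT1 r]]]]]; have [s hs] := pe; have [ma _ ep] := s'.
have [P [k' [e' [h [sP eh hk univ joint]]]]] := short_exact_pullback p s.
have TP : T P.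
  apply: (xT _ _ _ k' e') TK TT1; apply: proper_exactI => // W EW w.
  have [_ _ /(_ (p \oc w)) [v /esym ev]] := hs W EW.
  by have [u [_ <-]] := univ _ _ _ ev; exists u.
have [|b [hb eb]] := univ _ (0 : hom K' L) a.
  by rewrite compm0 (short_exact0 s').
exists K', P, b, h; split=> //; apply: short_exactI => //.
- by apply: (@mono_cancel _ _ _ _ e'); rewrite eb.
- apply: epi_in_imageP => W x.
  have [W' [d [y [ed]]]] := epi_lift (e \oc x) ep.
  rewrite -compA => /univ [u [hu _]].
  by exists W', d, u.
move=> W x hx; have [|u xu] := @short_exact_lift _ _ _ _ a p (e' \oc x) s'.
  by rewrite compA -eh -compA hx compm0.
suff -> : x = b \oc u by exact: in_imageT.
by apply: joint; rewrite compA ?hb ?eb // comp0m.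
Qed.

(** Replacing T0 by a proper cover C0 with kernel K in T turns the syzygy B into an extension L of B
    by K. It is [E]-proper as a pullback, so [resolves_proper] bounds the length for L. *)
Lemma resolves_TT_TC n X : resolves T T n X -> resolves T C n X.
Proof.
have [_ _ gC] := hC.
elim: n X => [|n IH] X //= [B [T0 [a [p [s TT0 r]]]]].
have [K [C0 [k [e [[sk hk] CC0 TK]]]]] := gC _ TT0.
have [L [l [k' [e' [sL s' el univ]]]]] := short_exact_kernel_comp sk s.
exists L, C0, l, (p \oc e); split=> //; apply: IH.
apply: (resolves_proper (k := k') (e := e')) TK r.
apply: proper_exactI => // W EW w.
have [_ _ /(_ (a \oc w)) [v /esym ev]] := hk W EW.
by have [u [_ <-]] := univ _ _ _ ev; exists u.
Qed.

(* If [0 -> D2 -> F -> D1 -> 0] and [0 -> D1 -> D0 -> X -> 0] start a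
   [C]-resolution of [X], then the pullback [P] of [C0] and [D0] over [X] is
   [C0 + D1] and is covered by [F + C0] with kernel [D2]; the preimage [F'] of
   the summand [B] of [P] is a summand of [F + C0]. *)
Lemma resolves_syzygy n m B C0 X (f : hom B C0) (g : hom C0 X) :
  short_exact f g -> C C0 -> resolves T C n B -> resolves C C m.+2 X ->
  resolves C C m.+1 B.
Proof.
move=> s CC0 rB [D1 [D0 [a [p [sD CD0 [D2 [F [b [q [sF CF rD2]]]]]]]]]].
have [P [b1 [b2 [h [sP gh hb univ joint]]]]] := short_exact_pullback p s.
have [_ _ eg] := s; have [ma _ _] := sD.
have rD1 : resolves C C m.+1 D1 by exists D2, F, b, q.
(* Ext^1(C0, D1) = 0 lifts [g] to D0, which splits P -> C0; [j] and [c] are the inclusions of D1 and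
   C0 into P. *)
have [t pt] : exists t : hom C0 D0, p \oc t = g.
  exact: (Ext_splits_lift g sD (Ext_vanishes1 (Ext_vanishes_T (CT CC0) rD1))).
have [j [hj bj]] : exists j : hom D1 P, h \oc j = 0 /\ b2 \oc j = a.
  by apply: univ; rewrite compm0 (short_exact0 sD).
have [c [hc bc]] : exists c : hom C0 P, h \oc c = idm C0 /\ b2 \oc c = t.
  by apply: univ; rewrite compm1 pt.
have [S bS] := biproduct_ex F C0.
have CS : C S := biproduct_closed C_additive C_iso bS CF CC0.
have [i1 [i2 [p1 [p2 [h1 h2 h3 h4 h5]]]]] := bS.
have [mb _ eq] := sF.
pose k := i1 \oc b; pose e := j \oc q \oc p1 + c \oc p2.
have sS : short_exact k e.
  apply: short_exactI; last move=> W x ex.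
  - by apply: (@mono_cancel _ _ _ _ p1); rewrite /k compA h1 comp1m.
  - apply: epi_in_imageP => W x.
    have [|y xy] := @short_exact_lift _ _ _ _ a p (b2 \oc (x - c \oc (h \oc x))) sD.
      rewrite compA -gh -compA compBr (compA h c) hc comp1m subrr.
      exact: compm0.
    have [W' [d [z [ed ez]]]] := epi_lift y eq.
    exists W', d, (i1 \oc z + i2 \oc (h \oc x \oc d)); split=> //.
    have -> : e \oc (i1 \oc z + i2 \oc (h \oc x \oc d))
        = j \oc (q \oc z) + c \oc (h \oc x \oc d).
      rewrite /e compDl !compDr -!compA !(compA p1) !(compA p2) h1 h2 h3 h4.
      by rewrite !comp1m !comp0m !compm0 addr0 add0r.
    rewrite -ez; apply: joint.
      by rewrite compDr (compA h j) hj comp0m add0r (compA h c) hc comp1m compA.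
    rewrite compDr (compA b2 j) bj (compA a y) -xy compBr compBl -!compA.
    by rewrite subrK.
  - rewrite /e /k compDl -!compA !(compA p1) !(compA p2) h1 h4.
    by rewrite comp1m (short_exact0 sF) comp0m !compm0 addr0.
  have p2x : p2 \oc x = 0.
    move/(congr1 (comp h)): (ex).
    rewrite /e compDl compDr compm0 -!compA (compA h j) hj comp0m add0r.
    by rewrite (compA h c) hc comp1m.
  have [|y xy] := @short_exact_lift _ _ _ _ b q (p1 \oc x) sF.
    apply: (mono0 ma); move/(congr1 (comp b2)): (ex).
    rewrite /e compDl compDr compm0 -!compA p2x !compm0 addr0.
    by rewrite (compA b2 j) bj.
  suff -> : x = k \oc y by exact: in_imageT.
  by rewrite -(comp1m x) -h5 compDl -!compA p2x compm0 addr0 xy /k compA.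
have [F' [l [k' [e' [sL sF' _ _]]]]] := short_exact_kernel_comp sS sP.
(* P -> D0 splits since Ext^1(D0, B) = 0, and the section lifts to S since Ext^1(D0, D2) = 0; so S
   is F' + D0. *)
have [t1 pt1] : exists t1 : hom D0 P, b2 \oc t1 = idm D0.
  exact: (Ext_splits_section (Ext_vanishes1 (Ext_vanishes_C CD0 rB)) sP).
have [t2 et2] : exists t2 : hom D0 S, e \oc t2 = t1.
  exact: (Ext_splits_lift t1 sS (Ext_vanishes1 (Ext_vanishes_T (CT CD0) rD2))).
have CF' : C F'.
  apply: hsum CS; apply: (short_exact_biproduct (t := t2) sL).
  by rewrite -compA et2.
by exists D2, F', k', e'.
Qed.

Lemma resolves_TC_CC n m X :
  resolves T C n X -> resolves C C m X -> resolves C C n X.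
Proof.
elim: n m X => [|n IH] m X.
  move=> TX /(resolves_pad C_additive C_iso) [D1 [D0 [a [p [s CD0 r]]]]].
  apply: hsum CD0; apply: biproductC.
  exact: (Ext_splits_biproduct s (Ext_vanishes1 (Ext_vanishes_T TX r))).
move=> [B [C0 [f [g [s CC0 rB]]]]] rX.
exists B, C0, f, g; split=> //; apply: (IH m.+1) => //.
apply: (resolves_syzygy s CC0 rB).
(* [resolves_syzygy] takes a resolution of length at least two, while [m] may be smaller. *)
by do 2!apply: (resolves_pad C_additive C_iso).
Qed.

(* An Auslander-Buchweitz approximation: [K] has C-dimension less than [n]. *)
Lemma T_approximation n X : cogenerator C T -> resolves T C n X ->
  exists K P (k : hom K P) (p : hom P X),
    [/\ short_exact k p, T P
      & if n is m.+1 then resolves C C m K else zero_object K].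
Proof.
move=> [_ _ cog]; elim: n X => [|n IH] X /=.
  move=> TX; have [Z hZ] := zero_ex; exists Z, X, 0, (idm X); split=> //.
  by apply: zero_short_exact => //; [exact: mono_id|exact: epi_id].
move=> [B [C0 [f [g [s CC0 /IH [K [P [k [p [sP TP rK]]]]]]]]]].
have [D [T' [i [q [sD CD TT']]]]] := cog _ TP.
have [Q [u [j [h [sQ sB _ _]]]]] := short_exact_cokernel_comp sP sD.
have [Y [v [c [w [sY vj wv mv univ]]]]] := short_exact_pushout f sB.
have [mf _ eg] := s; have {}mv := mv mf; have [mj _ _] := sB; have [mc _ _] := sY.
have TY : T Y.
  (* T is closed only under proper extensions; Y, an extension of T' by C0, lies in T because it
     splits. *)
  have bY := Ext_splits_biproduct sY (Ext_vanishes1 (Ext_vanishes_TC TT' CC0)).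
  exact: biproduct_closed T_additive T_iso bY (CT CC0) TT'.
have [|z [zv zc]] := univ X (0 : hom Q X) g.
  by rewrite comp0m (short_exact0 s).
exists Q, Y, v, z; split=> //; last first.
  case: n rK {IH} => [hK|n rK]; last by exists K, D, (i \oc k), u.
  apply: (C_iso (f := u)) CD; have [_ _ eu] := sQ => //.
  apply/mono0P => W x /(short_exact_lift sQ) [y ->].
  by rewrite (zero_to y) ?compm0.
have [_ _ eh] := sB.
apply: short_exactI => //; last move=> W x zx.
  by apply: (@epi_cancel _ _ _ _ _ c); rewrite zc.
have [W' [d [y [ed ey]]]] := epi_lift (w \oc x) eh.
have [|m xm] := @short_exact_lift _ _ _ _ c w (x \oc d - v \oc y) sY.
  by rewrite compBr !compA wv ey subrr.
have [|b mb] := @short_exact_lift _ _ _ _ f g m s.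
  by rewrite -zc -compA -xm compBr !compA zx zv !comp0m subrr.
exists W', d, (y + j \oc b); split=> //.
by rewrite compDr compA vj -compA -mb -xm addrC subrK.
Qed.

(** Embed P in C0 with cokernel T', and let Q be C0 / K, an extension of T' by X. A section of Q ->
    T' exists since Ext^1(T', X) = 0 and lifts to C0 since Ext^1(T', K) = 0. *)
Lemma resolves_perp n X :
  cogenerator C T -> right_perp T X -> resolves T C n X -> resolves C C n X.
Proof.
move=> cog perpX r.
have [K [P [k [p [s TP rK]]]]] := T_approximation cog r; have [mk _ ep] := s.
have vK W : T W -> Ext_vanishes W K.
  move=> TW; case: n rK {r} => [hK|n rK]; last exact: Ext_vanishes_T rK.
  by apply: Ext_vanishes_TC => //; exact: zero_closed C_additive C_iso hK.
suff CP : C P.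
  case: n rK {r} => [hK|n rK]; last by exists K, P, k, p.
  apply: (C_iso (f := p)) CP => //.
  apply/mono0P => W x /(short_exact_lift s) [y ->].
  by rewrite (zero_to y) ?compm0.
have [_ _ /(_ _ TP) [C0 [T' [i [q [sC CC0 TT']]]]]] := cog.
have [Q [u [j [h [sQ sX _ hu]]]]] := short_exact_cokernel_comp s sC.
have [|t ht] := @Ext_splits_section _ _ _ j h _ sX.
  by apply: Ext_zero_splits; exact: perpX.
have [t' ut'] := Ext_splits_lift t sQ (Ext_vanishes1 (vK _ TT')).
apply: hsum CC0; apply: (short_exact_biproduct (t := t') sC).
by rewrite -hu -compA ut'.
Qed.

Lemma finite_dim_resolution (P : subcat A) X :
  finite_dim P X -> exists n, has_resolution P X n.
Proof.
rewrite /finite_dim /dim; case: pselect => // e _.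
by case: e => n /asboolP; exists n.
Qed.

Lemma resolves_incl (P Q R : subcat A) n X :
  subcat_incl P Q -> subcat_incl P R -> resolves P P n X -> resolves Q R n X.
Proof.
move=> PQ PR; elim: n X => [|n IH] X; first exact: PQ.
by move=> [K [D [f [g [s PD /IH r]]]]]; exists K, D, f, g; split=> //; exact: PR.
Qed.

End Dimension.
End Abelian.

Theorem theorem3p10 (A : preadditiveCategory) (hA : abelian A)
    (E T C : subcat A)
    (hE : additive_subcat E)
    (hT : preresolving E T)
    (hC : proper_generator E C T)
    (hperp : forall X : A, T X -> right_perp C X /\ left_perp C X)
    (hsum : closed_summands C)
    (X : A)
    (hcond :
      (finite_dim C X /\ subcat_eq E C /\ closed_proper_kernels C T) \/
      (finite_dim C X /\ subcat_eq E C /\ closed_summands (finite_dim C)) \/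
      (right_perp T X /\ cogenerator C T)) :
  dim T X = dim C X.
Proof.
have iC := C_iso hA hsum; have iT := T_iso hA hT.
(* More than equal dimensions is shown: resolutions of both kinds exist for the same lengths. *)
suff e : has_resolution T X = has_resolution C X by rewrite /dim e.
apply/funext => n; apply/propext.
rewrite (has_resolutionP hA _ _ iT) (has_resolutionP hA _ _ iC).
split; last by apply: resolves_incl => Y; exact: (CT hC).
move=> /(resolves_TT_TC hA hT hC) r.
(* The length [m] of some C-resolution, however large, is cut down to [n]. *)
have fin : finite_dim C X -> resolves C C n X.
  move=> /finite_dim_resolution [m rm].
  apply: (resolves_TC_CC hA hC hperp hsum r (m := m)).
  exact: (has_resolutionP hA m X iC).1.
case: hcond => [[/fin]|[[/fin]|[perpX cog]]] //.
exact: (resolves_perp hA hT hC hperp hsum cog perpX r).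
Qed.
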